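(* Let $(p_n)_{n\ge1}$ be a sequence of integers with $1\le p_n\le n$. Suppose that $\pi_n$ has exponential decrease, i.e. there are constants $C>0$ and $D<1$, not depending on $n$, such that $$\pi_n(p)\le D\,\pi_n(p-1)\qquad\text{for all integers } p \text{ with } Cp_n<p\le n .$$ Suppose that for every $S$ the density $g_S$ is the product of $|S|$ copies of a fixed univariate probability density $g$ on $\mathbb{R}$ with mean zero and finite second moment. Then there exists $M>0$ such that, as $p_n,n\to\infty$, $$\sup_{\theta_0\in\ell_0[p_n]}P_{n,\theta_0}\,\Pi_n\bigl(\theta: |S_\theta|>Mp_n\mid X\bigr)\to0 .$$
   Context: For $\theta\in\mathbb{R}^n$, $P_{n,\theta}$ denotes the $N_n(\theta,I)$ distribution of $X=(X_1,\dots,X_n)$, with Lebesgue density $p_{n,\theta}$, and $P_{n,\theta}T$ denotes the expectation of $T=T(X)$ under it. The support of $\theta$ is $S_\theta=\{i:\theta_i\ne0\}$; $|S|$ is the cardinality of $S$; $\ell_0[p]=\{\theta\in\mathbb{R}^n:|S_\theta|\le p\}$. Prior $\Pi_n$ on $\mathbb{R}^n$: (P1) a dimension $p$ is drawn from a probability measure $\pi_n$ on $\{0,1,\dots,n\}$ with $\pi_n(p)>0$ for every $p$; (P2) given $p$, a subset $S\subset\{1,\dots,n\}$ with $|S|=p$ is drawn uniformly from the $\binom np$ subsets of size $p$; (P3) given $(p,S)$, the vector $\theta_S=(\theta_i:i\in S)$ is drawn from a probability density $g_S$ on $\mathbb{R}^S$ (if $p\ge1$), and the coordinates $\theta_i$,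 $i\notin S$, are set equal to $0$. Posterior: $\Pi_n(B\mid X)=\int_B p_{n,\theta}(X)\,d\Pi_n(\theta)\big/\int p_{n,\theta}(X)\,d\Pi_n(\theta)$ for Borel $B\subset\mathbb{R}^n$. *)

(* Defs.v *)
From HB Require Import structures.
From mathcomp Require Import all_boot all_order all_algebra.
From mathcomp Require Import all_classical all_reals all_analysis measurable_realfun.

Set Implicit Arguments.
Unset Strict Implicit.
Unset Printing Implicit Defensive.

Import Order.TTheory GRing.Theory Num.Theory.
Import numFieldNormedType.Exports.

Local Open Scope classical_set_scope.
Local Open Scope ring_scope.

(* R^n is [n.-tuple R] with its product sigma-algebra, which is the Borel one. *)

Section tuple_measure.
Context (R : realType).
Local Open Scope ereal_scope.

Definition tuple_cons n (x : measurableTypeR R * n.-tuple R) : n.+1.-tuple R :=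
  [tuple of x.1 :: x.2].

Lemma measurable_tuple_cons n : measurable_fun setT (@tuple_cons n).
Proof. exact: (@measurable_cons _ _ _ R fst n snd). Qed.

Section step.
Variables (n : nat) (m : {sigma_finite_measure set (n.-tuple R) -> \bar R}).

Definition lebesgue_cons : set (n.+1.-tuple R) -> \bar R :=
  pushforward (lebesgue_measure \x m) (@tuple_cons n).

Let lebesgue_cons0 : lebesgue_cons set0 = 0.
Proof. by rewrite /lebesgue_cons /pushforward preimage_set0 measure0. Qed.

Let lebesgue_cons_ge0 A : 0 <= lebesgue_cons A.
Proof. by rewrite /lebesgue_cons /pushforward measure_ge0. Qed.

Let lebesgue_cons_sigma_additive : semi_sigma_additive lebesgue_cons.
Proof.
have mf := @measurable_tuple_cons n.
move=> F mF tF mUF; rewrite /lebesgue_cons /pushforward preimage_bigcup.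
apply: measure_semi_sigma_additive.
- by move=> k; rewrite -[X in measurable X]setTI; exact: mf.
- apply/trivIsetP => /= i j _ _ ij; rewrite -preimage_setI.
  by move/trivIsetP : tF => /(_ _ _ _ _ ij) ->//; rewrite preimage_set0.
- by rewrite -preimage_bigcup -[X in measurable X]setTI; exact: mf.
Qed.

HB.instance Definition _ := isMeasure.Build _ _ _ lebesgue_cons
  lebesgue_cons0 lebesgue_cons_ge0 lebesgue_cons_sigma_additive.

Let lebesgue_cons_sigma_finite : sigma_finite setT lebesgue_cons.
Proof.
have [F FT Foo] : sigma_finite setT (lebesgue_measure \x m).
  have /sigma_finiteP[F [TF ndF Foo]] := sigma_finiteT (@lebesgue_measure R).
  have /sigma_finiteP[G [TG ndG Goo]] := sigma_finiteT m.
  exists (fun k => F k `*` G k).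
    rewrite -setXTT TF TG predeqE => -[x y]; split.
      move=> [/= [i _ Fix] [k _ Gky]]; exists (maxn i k) => //; split.
      - by move: x Fix; exact/subsetPset/ndF/leq_maxl.
      - by move: y Gky; exact/subsetPset/ndG/leq_maxr.
    by move=> [i _ []/= ? ?]; split; exists i.
  move=> k; have [? ?] := Foo k; have [? ?] := Goo k.
  split; first exact: measurableX.
  by rewrite product_measure1E// lte_mul_pinfty// ge0_fin_numE.
pose u (t : n.+1.-tuple R) : measurableTypeR R * n.-tuple R :=
  (thead t, [tuple of behead t]).
have mu_ : measurable_fun setT u.
  apply/measurable_fun_pairP; split.
    exact: (@measurable_tnth _ R n.+1 ord0).
  exact: (@measurable_behead _ R n).
have uK x : u (tuple_cons x) = x.
  case: x => a b; congr pair.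
  exact: val_inj.
exists (fun k => u @^-1` F k).
  by rewrite -preimage_bigcup -FT preimage_setT.
move=> k; have [mFk Fkoo] := Foo k; split.
  by rewrite -[X in measurable X]setTI; exact: mu_.
rewrite /lebesgue_cons /pushforward.
suff -> : @tuple_cons n @^-1` (u @^-1` F k) = F k by [].
by apply/seteqP; split => x /=; rewrite uK.
Qed.

HB.instance Definition _ := Measure_isSigmaFinite.Build _ _ _ lebesgue_cons
  lebesgue_cons_sigma_finite.

End step.

(* Lebesgue measure on R^n; on the one-point space R^0 it is the unit mass. *)
Fixpoint lebesgue_tuple n : {sigma_finite_measure set (n.-tuple R) -> \bar R} :=
  match n with
  | 0%N => dirac ([tuple] : 0.-tuple R)
  | n'.+1 => lebesgue_cons (lebesgue_tuple n')
  end.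

End tuple_measure.

Section prob_density.
Context d (T : measurableType d) (R : realType).
Variable mu : {measure set T -> \bar R}.
Local Open Scope ereal_scope.

Record prob_density := ProbDensity {
  pdf :> T -> R ;
  measurable_pdf : measurable_fun setT pdf ;
  pdf_ge0 : forall x, (0 <= pdf x)%R ;
  integral_pdf : \int[mu]_x (pdf x)%:E = 1 }.

Definition density_law (f : prob_density) : set T -> \bar R :=
  fun A => \int[mu]_(x in A) (f x)%:E.

Variable f : prob_density.

Let density_law0 : density_law f set0 = 0.
Proof. by rewrite /density_law integral_set0. Qed.

Let density_law_ge0 A : 0 <= density_law f A.
Proof. by apply: integral_ge0 => x _; rewrite lee_fin pdf_ge0. Qed.

Let density_law_sigma_additive : semi_sigma_additive (density_law f).
Proof.
move=> A mA tA mUA; rewrite /density_law.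
rewrite ge0_integral_bigcup//; last 2 first.
- by apply/measurable_EFinP/measurable_funTS; exact: measurable_pdf.
- by move=> x _; rewrite lee_fin pdf_ge0.
apply: is_cvg_ereal_nneg_natsum_cond => n _ _.
by apply: integral_ge0 => x _; rewrite lee_fin pdf_ge0.
Qed.

HB.instance Definition _ := isMeasure.Build _ _ _ (density_law f)
  density_law0 density_law_ge0 density_law_sigma_additive.

Let density_law_setT : density_law f setT = 1.
Proof. exact: integral_pdf. Qed.

HB.instance Definition _ := Measure_isProbability.Build _ _ _ (density_law f)
  density_law_setT.

End prob_density.

Section gaussian.
Context (R : realType).

Definition gauss_pdf n (theta x : n.-tuple R) : R :=
  \prod_(i < n) normal_pdf (tnth theta i) 1 (tnth x i).

Lemma measurable_gauss_pdf n (theta : n.-tuple R) :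
  measurable_fun setT (gauss_pdf theta).
Proof.
apply: measurable_prod => i _.
apply: (@measurableT_comp _ _ _ _ _ _ (normal_pdf (tnth theta i) 1)).
  exact: measurable_normal_pdf.
exact: measurable_tnth.
Qed.

Lemma gauss_pdf_ge0 n (theta x : n.-tuple R) : 0 <= gauss_pdf theta x.
Proof. by apply: prodr_ge0 => i _; exact: normal_pdf_ge0. Qed.

Lemma integral_gauss_pdf n (theta : n.-tuple R) :
  (\int[lebesgue_tuple R n]_x (gauss_pdf theta x)%:E = 1)%E.
Proof.
elim: n theta => [|n IHn] theta.
  rewrite /= integral_dirac//=; last first.
    by apply/measurable_EFinP; exact: measurable_gauss_pdf.
  by rewrite /gauss_pdf big_ord0 diracT mul1e.
rewrite [lebesgue_tuple R n.+1]/= /lebesgue_cons.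
rewrite ge0_integral_pushforward//; last 3 first.
- exact: measurable_tuple_cons.
- by apply/measurable_EFinP; exact: measurable_gauss_pdf.
- by move=> x _; rewrite lee_fin gauss_pdf_ge0.
have E x : ((fun y => (gauss_pdf theta y)%:E) \o @tuple_cons R n) x =
    ((normal_pdf (thead theta) 1 x.1)%:E *
     (gauss_pdf [tuple of behead theta] x.2)%:E)%E.
  have E1 i : tnth theta (lift ord0 i) = tnth [tuple of behead theta] i.
    by rewrite [in LHS](tuple_eta theta) tnthS.
  have E2 i : tnth (tuple_cons x) (lift ord0 i) = tnth x.2 i.
    by rewrite /tuple_cons tnthS.
  rewrite /comp -EFinM /gauss_pdf big_ord_recl.
  by under eq_bigr do rewrite E1 E2.
rewrite preimage_setT (eq_integral _ _ (fun x _ => E x)).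
rewrite fubini_tonelli1//=; last 2 first.
- apply: emeasurable_funM; apply/measurable_EFinP.
    apply: (@measurableT_comp _ _ _ _ _ _ (normal_pdf (thead theta) 1)) => //.
    exact: measurable_normal_pdf.
  by apply: measurableT_comp => //; exact: measurable_gauss_pdf.
- by move=> x; rewrite -EFinM lee_fin mulr_ge0 ?normal_pdf_ge0 ?gauss_pdf_ge0.
rewrite -(integral_normal_pdf (thead theta) 1); apply: eq_integral => x _.
rewrite /fubini_F/= ge0_integralZl//; last 3 first.
- by apply/measurable_EFinP; exact: measurable_gauss_pdf.
- by move=> y _; rewrite lee_fin gauss_pdf_ge0.
- by rewrite lee_fin normal_pdf_ge0.
by rewrite IHn mule1.
Qed.

Definition gauss_density n (theta : n.-tuple R) :
    prob_density (lebesgue_tuple R n) :=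
  ProbDensity (measurable_gauss_pdf theta) (gauss_pdf_ge0 theta)
    (integral_gauss_pdf theta).

(* N_n(theta, I) *)
Definition gauss_law n (theta : n.-tuple R) : probability (n.-tuple R) R :=
  density_law (gauss_density theta).

End gaussian.

Section sparsity.
Context (R : realType) (n : nat).

Definition supp (theta : n.-tuple R) : {set 'I_n} :=
  [set i | tnth theta i != 0]%SET.

Definition l0_ball (q : nat) : set (n.-tuple R) :=
  [set theta | (#|supp theta| <= q)%N].

End sparsity.

Section prior.
Context (R : realType) (n : nat).

(* A strictly positive probability mass function on {0, ..., n}; the values
   at arguments larger than n play no role. *)
Record dim_prior := DimPrior {
  dim_pmf :> nat -> R ;
  dim_pmf_gt0 : forall q, (q <= n)%N -> 0 < dim_pmf q ;
  sum_dim_pmf : \sum_(q < n.+1) dim_pmf q = 1 }.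

(* R^S is represented by #|S|.-tuple R, the coordinates being listed in the
   order of [enum S]. *)
Definition embed (S : {set 'I_n}) (x : #|S|.-tuple R) : n.-tuple R :=
  [tuple if i \in S then nth 0 x (index i (enum S)) else 0 | i < n].

Lemma measurable_embed (S : {set 'I_n}) : measurable_fun setT (@embed S).
Proof.
apply/measurable_fun_tnthP => i.
rewrite (_ : _ \o _ = fun x : #|S|.-tuple R =>
    if i \in S then nth 0 x (index i (enum S)) else 0); last first.
  by apply/funext => x /=; rewrite tnth_mktuple.
have [iS|_] := boolP (i \in S); last exact: measurable_cst.
have ltS : (index i (enum S) < #|S|)%N by rewrite cardE index_mem mem_enum.
rewrite (_ : (fun _ => _) = (@tnth _ R ^~ (Ordinal ltS))); last first.
  by apply/funext => x; rewrite (tnth_nth 0).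
exact: measurable_tnth.
Qed.

Variable w : dim_prior.
Variable gS : forall S : {set 'I_n}, prob_density (lebesgue_tuple R #|S|).
Local Open Scope ereal_scope.

Definition prior (A : set (n.-tuple R)) : \bar R :=
  \sum_(q < n.+1) (w q)%:E *
    \sum_(S : {set 'I_n} | #|S| == q)
      ('C(n, q)%:R^-1)%:E * pushforward (density_law (gS S)) (@embed S) A.

Let w_ge0 (q : 'I_n.+1) : 0 <= (w q)%:E.
Proof. by rewrite lee_fin ltW// dim_pmf_gt0// -ltnS. Qed.

Let c_ge0 q : 0 <= ('C(n, q)%:R^-1 : R)%:E.
Proof. by rewrite lee_fin invr_ge0. Qed.

Let pf_ge0 (S : {set 'I_n}) A :
  0 <= pushforward (density_law (gS S)) (@embed S) A.
Proof. by rewrite /pushforward measure_ge0. Qed.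

Let prior0 : prior set0 = 0.
Proof.
rewrite /prior big1// => q _; rewrite big1 ?mule0// => S _.
by rewrite /pushforward preimage_set0 measure0 mule0.
Qed.

Let prior_ge0 A : 0 <= prior A.
Proof.
apply: sume_ge0 => q _; apply: mule_ge0 => //; apply: sume_ge0 => S _.
by apply: mule_ge0 => //; exact: pf_ge0.
Qed.

Let prior_sigma_additive : semi_sigma_additive prior.
Proof.
move=> F mF tF mUF.
have me S : measurable_fun setT (@embed S) := @measurable_embed S.
have mF' S k : measurable (@embed S @^-1` F k).
  by rewrite -[X in measurable X]setTI; exact: me.
have H S : pushforward (density_law (gS S)) (@embed S) (\bigcup_k F k) =
    \sum_(0 <= k <oo) pushforward (density_law (gS S)) (@embed S) (F k).
  rewrite /pushforward preimage_bigcup; apply/esym/cvg_lim => //.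
  apply: measure_sigma_additive; first by move=> k; exact: mF'.
  apply/trivIsetP => /= i j _ _ ij; rewrite -preimage_setI.
  by move/trivIsetP : tF => /(_ _ _ _ _ ij) ->//; rewrite preimage_set0.
suff -> : prior (\bigcup_k F k) = \sum_(0 <= k <oo) prior (F k).
  exact: is_cvg_ereal_nneg_natsum.
rewrite /prior nneseries_sum; last first.
  move=> q k _; apply: mule_ge0 => //; apply: sume_ge0 => S _.
  by apply: mule_ge0 => //; exact: pf_ge0.
apply: eq_bigr => q _; rewrite nneseriesZl//; last first.
  move=> k _; apply: sume_ge0 => S _.
  by apply: mule_ge0 => //; exact: pf_ge0.
congr (_ * _); rewrite nneseries_sum; last first.
  by move=> S k _; apply: mule_ge0 => //; exact: pf_ge0.
apply: eq_bigr => S _; rewrite nneseriesZl ?H//.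
Qed.

HB.instance Definition _ := isMeasure.Build _ _ _ prior
  prior0 prior_ge0 prior_sigma_additive.

Let prior_setT : prior setT = 1.
Proof.
rewrite /prior -(congr1 EFin (sum_dim_pmf w)) -sumEFin.
apply: eq_bigr => q _.
under eq_bigr do rewrite /pushforward preimage_setT probability_setT mule1.
rewrite sumEFin sumr_const.
rewrite (_ : #|_| = 'C(n, q)); last first.
  have := card_draws 'I_n q; rewrite card_ord => <-.
  by apply: eq_card => S; rewrite !inE.
rewrite -EFinM -[X in (_ * X)%R]mulr_natr mulVf ?mulr1//.
by rewrite pnatr_eq0 -lt0n bin_gt0 -ltnS.
Qed.

HB.instance Definition _ := Measure_isProbability.Build _ _ _ prior prior_setT.

End prior.

(* The likelihood is bounded and strictly positive and [P] has mass 1, so both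
   real-valued integrals are finite and the denominator is positive. *)
Definition posterior (R : realType) n (P : probability (n.-tuple R) R)
    (x : n.-tuple R) (B : set (n.-tuple R)) : R :=
  (\int[P]_(theta in B) gauss_pdf theta x) / (\int[P]_theta gauss_pdf theta x).

(* The hypotheses force 0 < q, so that [q.-1] is a genuine predecessor. *)
Definition exponential_decrease (R : realType) (p : nat -> nat)
    (w : forall n, dim_prior R n) : Prop :=
  exists C D : R, [/\ 0 < C, D < 1 &
    forall n q : nat, (0 < n)%N -> C * (p n)%:R < q%:R -> (q <= n)%N ->
      w n q <= D * w n q.-1].

(* Main.v *)
(* Let r(x) be the ratio at x of the marginal density of one observation, whose
   mean has density g, to the standard normal density. Up to a common factor the
   posterior weight of a model S is pi_n(|S|) / C(n,|S|) * prod_(i in S) r(X_i).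
   As g has mean zero and finite second moment, Jensen's inequality gives a
   constant kappa > 0 with r >= kappa everywhere; moreover E r(X_i) = 1 when
   theta0_i = 0.

   Let A be the support of theta0, and q a multiple of p_n beyond which pi_n
   decreases geometrically. In the denominator keep only the models Q of size q
   and bound r below by kappa off A; what remains is a function of X_A alone.
   Taking the expectation over the coordinates off A then replaces the product
   over S in the numerator by the product over the trace of S on A. Finally,
   the average over the sets S of size p of a function of S :&: A is at most
   C(p, k), k <= q, times the average over those of size q, and this factor is
   absorbed by the geometric decrease of pi_n as soon as p > M p_n. *)
Require Import Defs.
From mathcomp Require Import all_boot all_order all_algebra.
From mathcomp Require Import all_classical all_reals all_analysis
  measurable_realfun.
From mathcomp Require Import ring lra zify.

Set Implicit Arguments.
Unset Strict Implicit.
Unset Printing Implicit Defensive.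

Import Order.TTheory GRing.Theory Num.Theory.
Import numFieldNormedType.Exports.

Local Open Scope classical_set_scope.
Local Open Scope ring_scope.

(** * Integration against a law with a density *)

Section integration.
Local Open Scope ereal_scope.

(** The integral of a nonnegative function is a supremum over the simple functions below it. This
    form serves for the posterior mass as a function of the data, whose measurability is not
    established. *)
Lemma ge0_le_integralT d (T : measurableType d) (R : realType)
    (mu : {measure set T -> \bar R}) (f h : T -> \bar R) :
  (forall x, 0 <= f x) -> (forall x, f x <= h x) ->
  \int[mu]_x f x <= \int[mu]_x h x.
Proof.
move=> f0 fh; rewrite !ge0_integralTE//; last first.
  by move=> x; exact: le_trans (f0 x) (fh x).
apply: le_ereal_sup => _ [k kf <-]; exists k => // x.
exact: le_trans (kf x) (fh x).
Qed.

Section density.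
Context d (T : measurableType d) (R : realType).
Variables (mu : {measure set T -> \bar R}) (f : prob_density mu).

Import HBNNSimple.

Let mf : measurable_fun setT (EFin \o f).
Proof. by apply/measurable_EFinP; exact: measurable_pdf. Qed.

Let f0 x : 0 <= (f x)%:E.
Proof. by rewrite lee_fin pdf_ge0. Qed.

Let integral_density_nnsfun (h : {nnsfun T >-> R}) :
  \int[density_law f]_x (h x)%:E = \int[mu]_x ((f x)%:E * (h x)%:E).
Proof.
under [LHS]eq_integral do rewrite fimfunE -fsumEFin//.
rewrite [LHS]ge0_integral_fsum//; last 2 first.
- by move=> r; exact/measurable_EFinP/measurable_funM.
- by move=> n x _; rewrite EFinM nnfun_muleindic_ge0.
under [RHS]eq_integral.
  move=> x xD; rewrite fimfunE -fsumEFin// ge0_mule_fsumr; last first.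
    by move=> r; rewrite EFinM nnfun_muleindic_ge0.
  over.
rewrite [RHS]ge0_integral_fsum//; last 2 first.
- by move=> r; apply: emeasurable_funM => //; exact/measurable_EFinP/measurable_funM.
- by move=> n x _; rewrite EFinM mule_ge0// nnfun_muleindic_ge0.
apply: eq_fsbigr => r _.
rewrite integralZl_indic_nnsfun//= integral_indic// setIT.
(* A negative [r] is not a value of [h]: its fibre is empty and both sides vanish. *)
have [r0|r0] := leP 0%R r.
  under [RHS]eq_integral => x _ do rewrite EFinM muleCA.
  rewrite ge0_integralZl//; last 2 first.
  - by apply: emeasurable_funM => //; exact/measurable_EFinP.
  - by move=> x _; rewrite mule_ge0// lee_fin.
  congr (_ * _); rewrite [LHS]integral_mkcond.
  apply: eq_integral => x _; rewrite patchE indicE -EFinM.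
  by case: ifPn; rewrite ?mulr1 ?mulr0.
rewrite preimage_nnfun0// measure0 mule0 integral0_eq// => x _.
by rewrite indicE in_set0 mulr0 mule0.
Qed.

(** Passes from simple functions to nonnegative measurable ones by monotone convergence on both
    sides. *)
Lemma ge0_integral_density (h : T -> \bar R) :
  measurable_fun setT h -> (forall x, 0 <= h x) ->
  \int[density_law f]_x h x = \int[mu]_x ((f x)%:E * h x).
Proof.
move=> mh h0; pose h_ := nnsfun_approx measurableT mh.
transitivity (limn (fun n => \int[density_law f]_x (h_ n x)%:E)).
  rewrite -monotone_convergence//=.
  - apply: eq_integral => x _; apply/esym/cvg_lim => //=.
    exact: cvg_nnsfun_approx.
  - by move=> n; exact/measurable_EFinP.
  - by move=> n x _; rewrite lee_fin.
  - by move=> x _ a b ab; rewrite lee_fin//; exact/lefP/nd_nnsfun_approx.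
transitivity (limn (fun n => \int[mu]_x ((f x)%:E * (h_ n x)%:E))).
  by congr (limn _); apply/funext => n; exact: integral_density_nnsfun.
rewrite -monotone_convergence//=.
- apply: eq_integral => x _; apply/cvg_lim => //=.
  by apply: cvgeZl => //; exact: cvg_nnsfun_approx.
- by move=> n; apply: emeasurable_funM => //; exact/measurable_EFinP.
- by move=> n x _; rewrite mule_ge0// lee_fin.
- move=> x _ a b ab; rewrite lee_wpmul2l// lee_fin.
  exact/lefP/nd_nnsfun_approx.
Qed.

End density.

End integration.

(** * Product densities on R^n *)

Section tuple_integration.
Context (R : realType).
Local Open Scope ereal_scope.
Local Notation mu := (@lebesgue_measure R).

Lemma measurable_prod_tnth n (f : 'I_n -> R -> R) :
  (forall i, measurable_fun setT (f i)) ->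
  measurable_fun setT (fun x : n.-tuple R => (\prod_(i < n) f i (tnth x i))%R).
Proof.
move=> mf; apply: measurable_prod => i _.
by apply: (@measurableT_comp _ _ _ _ _ _ (f i)) => //; exact: measurable_tnth.
Qed.

Lemma prod_tuple_cons n (f : 'I_n.+1 -> R -> R) (x : R) (y : n.-tuple R) :
  (\prod_(i < n.+1) f i (tnth (tuple_cons (x, y)) i) =
   f ord0 x * \prod_(i < n) f (lift ord0 i) (tnth y i))%R.
Proof.
rewrite big_ord_recl /tuple_cons/=; congr (_ * _)%R.
by apply: eq_bigr => i _; rewrite tnthS.
Qed.

Lemma measurable_tuple_cons2 n (h : n.+1.-tuple R -> \bar R) (x : R) :
  measurable_fun setT h ->
  measurable_fun setT (fun y : n.-tuple R => h (tuple_cons (x, y))).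
Proof.
move=> mh; apply: (measurableT_comp mh).
apply: (measurableT_comp (@measurable_tuple_cons R n)).
exact: measurable_fun_pair.
Qed.

Lemma ge0_integral_tuple_cons n (h : n.+1.-tuple R -> \bar R) :
  measurable_fun setT h -> (forall x, 0 <= h x) ->
  \int[lebesgue_tuple R n.+1]_x h x =
  \int[mu]_x \int[lebesgue_tuple R n]_y h (tuple_cons (x, y)).
Proof.
move=> mh h0; rewrite [lebesgue_tuple R n.+1]/= /lebesgue_cons.
rewrite ge0_integral_pushforward//; last exact: measurable_tuple_cons.
rewrite preimage_setT fubini_tonelli1//=.
- by apply: measurableT_comp => //; exact: measurable_tuple_cons.
Qed.

Lemma integral_prod_tnth n (f : 'I_n -> R -> R) (a : 'I_n -> R) :
  (forall i, measurable_fun setT (f i)) -> (forall i x, (0 <= f i x)%R) ->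
  (forall i, \int[mu]_x (f i x)%:E = (a i)%:E) ->
  \int[lebesgue_tuple R n]_x (\prod_(i < n) f i (tnth x i))%:E =
  (\prod_(i < n) a i)%:E.
Proof.
elim: n f a => [|n IHn] f a mf f0 fa.
  rewrite /= integral_dirac//=; last first.
    by apply/measurable_EFinP; exact: measurable_prod_tnth.
  by rewrite !big_ord0 diracT mul1e.
rewrite ge0_integral_tuple_cons//; last 2 first.
- by apply/measurable_EFinP; exact: measurable_prod_tnth.
- by move=> x; rewrite lee_fin; exact: prodr_ge0.
have fl0 (y : n.-tuple R) :
    (0 <= \prod_(i < n) f (lift ord0 i) (tnth y i))%R by exact: prodr_ge0.
transitivity (\int[mu]_x ((f ord0 x)%:E *
    (\prod_(i < n) a (lift ord0 i))%:E)).
  apply: eq_integral => x _.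
  under eq_integral => y _ do rewrite prod_tuple_cons EFinM.
  rewrite ge0_integralZl//; last 3 first.
  - apply/measurable_EFinP.
    exact: (measurable_prod_tnth (f := fun i => f (lift ord0 i))).
  - by move=> y _; rewrite lee_fin.
  - by rewrite lee_fin.
  by rewrite (IHn (fun i => f (lift ord0 i)) (fun i => a (lift ord0 i))).
have al0 : (0 <= \prod_(i < n) a (lift ord0 i))%R.
  apply: prodr_ge0 => i _; rewrite -lee_fin -fa; apply: integral_ge0 => x _.
  by rewrite lee_fin.
rewrite ge0_integralZr//; last 2 first.
- by apply/measurable_EFinP; exact: mf.
- by move=> x _; rewrite lee_fin.
by rewrite fa -EFinM big_ord_recl.
Qed.

(* Independence of the coordinates, phrased as insensitivity of the integral to
   the laws of the coordinates on which [h] does not depend. *)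
Lemma eq_integral_prod_density n (f f' : 'I_n -> prob_density mu)
    (h : n.-tuple R -> \bar R) :
  measurable_fun setT h -> (forall x, 0 <= h x) ->
  (forall i, f i =1 f' i \/ forall x y : n.-tuple R,
     (forall j, j != i -> tnth x j = tnth y j) -> h x = h y) ->
  \int[lebesgue_tuple R n]_x ((\prod_(i < n) f i (tnth x i))%:E * h x) =
  \int[lebesgue_tuple R n]_x ((\prod_(i < n) f' i (tnth x i))%:E * h x).
Proof.
elim: n f f' h => [|n IHn] f f' h mh h0 ff'.
  by apply: eq_integral => x _; rewrite !big_ord0.
have mp m (k : 'I_m -> prob_density mu) : measurable_fun setT
    (fun x : m.-tuple R => (\prod_(i < m) k i (tnth x i))%R).
  apply: (measurable_prod_tnth (f := fun i => k i)) => i.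
  exact: (measurable_pdf (k i)).
have p0 m (k : 'I_m -> prob_density mu) (x : m.-tuple R) :
    (0 <= \prod_(i < m) k i (tnth x i))%R.
  by apply: prodr_ge0 => i _; exact: pdf_ge0.
have mph m (k : 'I_m -> prob_density mu) (l : m.-tuple R -> \bar R) :
    measurable_fun setT l -> measurable_fun setT
      (fun x : m.-tuple R => (\prod_(i < m) k i (tnth x i))%:E * l x).
  by move=> ml; apply: emeasurable_funM => //; apply/measurable_EFinP; exact: mp.
have ph0 m (k : 'I_m -> prob_density mu) (l : m.-tuple R -> \bar R) x :
    (forall x, 0 <= l x) -> 0 <= (\prod_(i < m) k i (tnth x i))%:E * l x.
  by move=> l0; rewrite mule_ge0// lee_fin.
have split_head (k : 'I_n.+1 -> prob_density mu) :
    \int[lebesgue_tuple R n.+1]_x ((\prod_(i < n.+1) k i (tnth x i))%:E * h x) =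
    \int[mu]_x ((k ord0 x)%:E * \int[lebesgue_tuple R n]_y
       ((\prod_(i < n) k (lift ord0 i) (tnth y i))%:E * h (tuple_cons (x, y)))).
  rewrite ge0_integral_tuple_cons//; last 2 first.
  - exact: mph.
  - by move=> x; exact: ph0.
  apply: eq_integral => x _.
  rewrite -ge0_integralZl//; first last.
  - by rewrite lee_fin pdf_ge0.
  - move=> y _.
    exact: (ph0 _ (fun i => k (lift ord0 i)) (fun y => h (tuple_cons (x, y)))).
  - apply: (mph _ (fun i => k (lift ord0 i)) (fun y => h (tuple_cons (x, y)))).
    exact: measurable_tuple_cons2.
  apply: eq_integral => y _.
  by rewrite (prod_tuple_cons (fun i => k i)) EFinM muleA.
rewrite !split_head.
pose G x := \int[lebesgue_tuple R n]_y
  ((\prod_(i < n) f' (lift ord0 i) (tnth y i))%:E * h (tuple_cons (x, y))).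
transitivity (\int[mu]_x ((f ord0 x)%:E * G x)).
  apply: eq_integral => x _; congr (_ * _).
  apply: (IHn (fun i => f (lift ord0 i)) (fun i => f' (lift ord0 i))
              (fun y => h (tuple_cons (x, y)))) => //.
    exact: measurable_tuple_cons2.
  move=> i; have [e|hi] := ff' (lift ord0 i); [by left|right => y z yz].
  apply: hi => j; case: (unliftP ord0 j) => [k ->|->] ki; last by [].
  by rewrite /tuple_cons !tnthS yz//; apply: contra_neq ki => ->.
(* Either the two head densities agree, or [h], and with it [G], ignores the head coordinate, and
   every probability density integrates the constant [G] to itself. *)
have [ff0|h_indep] := ff' ord0.
  by apply: eq_integral => x _; rewrite ff0.
have GE x : G x = G 0%R.
  apply: eq_integral => y _; congr (_ * _); apply: h_indep => j.
  by case: (unliftP ord0 j) => [k ->|->] // _; rewrite /tuple_cons !tnthS.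
have G0 x : 0 <= G x.
  apply: integral_ge0 => y _.
  exact: (ph0 _ (fun i => f' (lift ord0 i)) (fun y => h (tuple_cons (x, y)))).
have aux (k : prob_density mu) : \int[mu]_x ((k x)%:E * G x) = G 0%R.
  under eq_integral do rewrite GE.
  rewrite ge0_integralZr//.
  - by rewrite integral_pdf mul1e.
  - by apply/measurable_EFinP; exact: measurable_pdf.
  - by move=> x _; rewrite lee_fin pdf_ge0.
by rewrite !aux.
Qed.

End tuple_integration.

(** * Integration against the prior *)

Section prior_integration.
Context (R : realType) (n : nat).
Local Open Scope ereal_scope.

Variables (w : dim_prior R n)
  (gS : forall S : {set 'I_n}, prob_density (lebesgue_tuple R #|S|)).

(** Law of the parameter given the model [S], kept transparent so that it unfolds to the
    pushforward. *)
Let model_law (S : {set 'I_n}) : {measure set (n.-tuple R) -> \bar R}.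
Proof.
unshelve refine (pushforward (density_law (gS S)) (@embed R n S) : measure _ _).
exact: measurable_embed.
Defined.

Definition model_weight (S : {set 'I_n}) : R := (w #|S| / 'C(n, #|S|)%:R)%R.

Lemma card_set_ord (S : {set 'I_n}) : (#|S| <= n)%N.
Proof. by rewrite -[leqRHS]card_ord max_card. Qed.

Lemma model_weight_gt0 S : (0 < model_weight S)%R.
Proof.
by rewrite divr_gt0 ?dim_pmf_gt0 ?card_set_ord// ltr0n bin_gt0 card_set_ord.
Qed.

Lemma priorE (A : set (n.-tuple R)) :
  prior w gS A =
  \sum_(S : {set 'I_n}) (model_weight S)%:E *
    pushforward (density_law (gS S)) (@embed R n S) A.
Proof.
(* Grouping the models by cardinality recovers the double sum; [inord] makes the cardinality, at
   most [n], an index of the outer one. *)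
rewrite (partition_big (fun S : {set 'I_n} => inord #|S| : 'I_n.+1) predT)//=.
apply: eq_bigr => q _; rewrite ge0_sume_distrr; last first.
  by move=> S _; rewrite mule_ge0 ?lee_fin ?invr_ge0// /pushforward measure_ge0.
apply: eq_big => [S|S /eqP Sq].
  by rewrite -val_eqE/= inordK// ltnS card_set_ord.
by rewrite muleA -EFinM -Sq.
Qed.

Lemma ge0_integral_prior (h : n.-tuple R -> \bar R) :
  measurable_fun setT h -> (forall x, 0 <= h x) ->
  \int[prior w gS]_x h x = \sum_(S : {set 'I_n}) (model_weight S)%:E *
    \int[density_law (gS S)]_y h (embed y).
Proof.
move=> mh h0.
(* [msum] is indexed by natural numbers, so the models are numbered by their position in
   [index_enum]; the default lies outside the range summed. *)
pose S_ k := nth finset.set0 (index_enum {set 'I_n}) k.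
pose m_ k : {measure set (n.-tuple R) -> \bar R} :=
  mscale (NngNum (ltW (model_weight_gt0 (S_ k)))) (model_law (S_ k)).
rewrite (eq_measure_integral (msum m_ (size (index_enum {set 'I_n})))); last first.
  move=> A mA _; rewrite [LHS]priorE (big_nth finset.set0) big_mkord.
  by apply: eq_bigr => k _.
rewrite ge0_integral_measure_sum// [RHS](big_nth finset.set0) big_mkord.
apply: eq_bigr => k _; rewrite ge0_integral_mscale//=.
rewrite ge0_integral_pushforward//; first exact: measurable_embed.
Qed.

End prior_integration.

(** * The marginal likelihood ratio of one observation *)

Section likelihood_ratio.
Context (R : realType) (g : prob_density (@lebesgue_measure R)).
Local Notation mu := (@lebesgue_measure R).

(** Likelihood ratio at [x] of the unit-variance normal laws with means [t] and 0. *)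
Definition tilt (x t : R) : R := expR (x * t - t ^+ 2 / 2).

(* Ratio at [x] of the marginal density of one observation whose mean has
   density [g] to the standard normal density. *)
Definition marginal_ratio (x : R) : R := \int[mu]_t (tilt x t * g t).

Lemma tilt_ge0 x t : 0 <= tilt x t. Proof. exact: expR_ge0. Qed.

Lemma tiltx0 x : tilt x 0 = 1.
Proof. by rewrite /tilt mulr0 expr0n/= mul0r subr0 expR0. Qed.

(** The exponent is largest at [t = x]; being uniform in [t], the bound makes [tilt x] integrable
    against [g]. *)
Lemma tilt_le x t : tilt x t <= expR (x ^+ 2 / 2).
Proof. by rewrite ler_expR; have := sqr_ge0 (x - t); lra. Qed.

Lemma normal_pdf_tilt x t : normal_pdf t 1 x = normal_pdf 0 1 x * tilt x t.
Proof.
rewrite !normal_pdfE// -mulrA; congr (_ * _).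
rewrite /normal_fun -expRD; congr expR.
by rewrite subr0 expr1n; field.
Qed.

Lemma measurable_tilt : measurable_fun setT (fun z : R * R => tilt z.1 z.2).
Proof.
apply: measurableT_comp => //; apply: measurable_funB.
  exact: measurable_funM.
apply: measurable_funM => //.
exact: measurable_funX.
Qed.

Lemma measurable_tilt2 x : measurable_fun setT (tilt x).
Proof.
apply: (measurableT_comp measurable_tilt (g := fun t => (x, t))).
exact: measurable_fun_pair.
Qed.

Let mg : measurable_fun setT g := measurable_pdf g.

Lemma integrable_density : mu.-integrable setT (EFin \o g).
Proof.
apply/integrableP; split; first exact/measurable_EFinP.
under eq_integral => x _ do rewrite gee0_abs ?lee_fin ?pdf_ge0//.
by rewrite integral_pdf ltry.
Qed.

Lemma integrable_tilt x : mu.-integrable setT (fun t => (tilt x t * g t)%:E).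
Proof.
have mt := measurable_tilt2 x.
apply: (@le_integrable _ _ _ mu setT measurableT _
    (fun t => ((expR (x ^+ 2 / 2))%:E * (g t)%:E)%E)).
- by apply/measurable_EFinP; exact: measurable_funM.
- move=> t _; rewrite -EFinM !gee0_abs ?lee_fin ?mulr_ge0 ?expR_ge0 ?pdf_ge0//.
  by rewrite ler_wpM2r ?pdf_ge0 ?tilt_le.
- by apply: integrableZl => //; exact: integrable_density.
Qed.

Lemma integral_tilt x :
  (\int[mu]_t (tilt x t * g t)%:E = (marginal_ratio x)%:E)%E.
Proof.
rewrite /marginal_ratio /Rintegral fineK//.
exact: integrable_fin_num (integrable_tilt x).
Qed.

Lemma marginal_ratio_ge0 x : 0 <= marginal_ratio x.
Proof. by apply: Rintegral_ge0 => t _; rewrite mulr_ge0 ?tilt_ge0 ?pdf_ge0. Qed.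

Lemma measurable_marginal_ratio : measurable_fun setT marginal_ratio.
Proof.
apply: measurableT_comp => //.
apply: (measurable_fun_fubini_tonelli_F (m2 := mu)
  (fun z : R * R => (tilt z.1 z.2 * g z.2)%:E)).
- apply/measurable_EFinP; apply: measurable_funM; first exact: measurable_tilt.
  by apply: measurableT_comp => //; exact: mg.
- by move=> z; rewrite lee_fin mulr_ge0 ?tilt_ge0 ?pdf_ge0.
Qed.

Definition marginal_pdf x : R := normal_pdf 0 1 x * marginal_ratio x.

Lemma measurable_marginal_pdf : measurable_fun setT marginal_pdf.
Proof.
apply: measurable_funM; first exact: measurable_normal_pdf.
exact: measurable_marginal_ratio.
Qed.

Lemma marginal_pdf_ge0 x : 0 <= marginal_pdf x.
Proof. by rewrite mulr_ge0 ?normal_pdf_ge0 ?marginal_ratio_ge0. Qed.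

(** By Tonelli the observation is integrated first: each normal density has mass one, which leaves
    the integral of [g]. *)
Lemma integral_marginal_pdf : (\int[mu]_x (marginal_pdf x)%:E = 1)%E.
Proof.
pose F (z : R * R) := (normal_pdf z.2 1 z.1 * g z.2)%:E.
have mF : measurable_fun setT F.
  apply/measurable_EFinP; apply: measurable_funM; last first.
    by apply: measurableT_comp => //; exact: mg.
  rewrite (_ : (fun x => _) = (fun z : R * R => normal_pdf 0 1 z.1 * tilt z.1 z.2)).
    apply: measurable_funM; last exact: measurable_tilt.
    by apply: (measurableT_comp (measurable_normal_pdf 0 1)).
  by apply/funext => z; rewrite normal_pdf_tilt.
transitivity (\int[mu]_x \int[mu]_t F (x, t))%E.
  apply: eq_integral => x _; rewrite EFinM -integral_tilt -ge0_integralZl//.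
  - by apply: eq_integral => t _; rewrite -EFinM mulrA -normal_pdf_tilt.
  - apply/measurable_EFinP; apply: measurable_funM => //; exact: measurable_tilt2.
  - by move=> t _; rewrite lee_fin mulr_ge0 ?tilt_ge0 ?pdf_ge0.
  - by rewrite lee_fin normal_pdf_ge0.
rewrite fubini_tonelli//; last first.
  by move=> z; rewrite lee_fin mulr_ge0 ?normal_pdf_ge0 ?pdf_ge0.
rewrite -[RHS](integral_pdf g); apply: eq_integral => t _.
under eq_integral => x _ do rewrite /F/= EFinM.
rewrite ge0_integralZr ?integral_normal_pdf ?mul1e//.
- by apply/measurable_EFinP; exact: measurable_normal_pdf.
- by move=> x _; rewrite lee_fin normal_pdf_ge0.
- by rewrite lee_fin pdf_ge0.
Qed.

Definition marginal_density : prob_density mu :=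
  @ProbDensity _ _ _ mu _ measurable_marginal_pdf marginal_pdf_ge0
    integral_marginal_pdf.

Section lower_bound.
Hypothesis mean0 : (\int[mu]_x (x * g x)%:E = 0)%E.
Hypothesis var_fin : (\int[mu]_x (x ^+ 2 * g x)%:E < +oo)%E.

Let var : R := \int[mu]_x (x ^+ 2 * g x).

Let sqg_ge0 x : 0 <= x ^+ 2 * g x.
Proof. by rewrite mulr_ge0 ?sqr_ge0 ?pdf_ge0. Qed.

Let msqg : measurable_fun setT (fun x : R => x ^+ 2 * g x).
Proof. by apply: measurable_funM => //; exact: measurable_funX. Qed.

Let integrable_sq : mu.-integrable setT (fun x => (x ^+ 2 * g x)%:E).
Proof.
apply/integrableP; split; first exact/measurable_EFinP.
by under eq_integral => x _ do rewrite gee0_abs ?lee_fin ?sqg_ge0//.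
Qed.

(** Domination through [|t| <= t^2 + 1]. *)
Let integrable_id : mu.-integrable setT (fun x => (x * g x)%:E).
Proof.
apply: (@le_integrable _ _ _ mu setT measurableT _
    (fun t => ((t ^+ 2 * g t)%:E + (g t)%:E)%E)).
- by apply/measurable_EFinP; exact: measurable_funM.
- move=> t _; rewrite -EFinD [leRHS]gee0_abs ?lee_fin ?addr_ge0 ?sqg_ge0 ?pdf_ge0//.
  rewrite normrM (ger0_norm (pdf_ge0 g t)) -[X in _ + X]mul1r -mulrDl.
  rewrite ler_wpM2r ?pdf_ge0// ler_norml.
  have := sqr_ge0 (t - 2^-1); have := sqr_ge0 (t + 2^-1); lra.
- by apply: integrableD => //; exact: integrable_density.
Qed.

(* Jensen: [expR] lies above its tangent at minus half the variance. *)
Lemma marginal_ratio_ge x : expR (- (var / 2)) <= marginal_ratio x.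
Proof.
rewrite -/var; set c := expR (- (var / 2)).
have il : mu.-integrable setT (fun t =>
    ((c * (1 + var / 2))%:E * (g t)%:E + (c * x)%:E * (t * g t)%:E)%E).
  apply: integrableD => //; apply: integrableZl => //.
  exact: integrable_density.
have iq : mu.-integrable setT (fun t => ((c / 2)%:E * (t ^+ 2 * g t)%:E)%E).
  exact: integrableZl.
(* The integrated tangent: mean zero removes the term in [x], and the two terms in [var] cancel. *)
have {1}-> : c = fine (\int[mu]_t (
   ((c * (1 + var / 2))%:E * (g t)%:E + (c * x)%:E * (t * g t)%:E) -
    (c / 2)%:E * (t ^+ 2 * g t)%:E))%E.
  rewrite integralB// integralD//; last 2 first.
  - by apply: integrableZl => //; exact: integrable_density.
  - exact: integrableZl.
  rewrite !integralZl//; last exact: integrable_density.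
  rewrite integral_pdf mean0 mule0 adde0 mule1.
  have -> : (\int[mu]_x0 (x0 ^+ 2 * g x0)%:E = var%:E)%E.
    by rewrite /var /Rintegral fineK//; exact: integrable_fin_num integrable_sq.
  by rewrite -EFinM -EFinB/=; field.
rewrite -lee_fin fineK; last first.
  by apply: integrable_fin_num => //; exact: integrableB.
rewrite -integral_tilt; apply: le_integral => //.
- exact: integrableB.
- exact: integrable_tilt.
move=> t _; rewrite -!EFinM lee_fin.
have -> : c * (1 + var / 2) * g t + c * x * (t * g t) - c / 2 * (t ^+ 2 * g t) =
  c * (1 + (var / 2 + (x * t - t ^+ 2 / 2))) * g t by field.
rewrite ler_wpM2r ?pdf_ge0//.
have -> : tilt x t = c * expR (var / 2 + (x * t - t ^+ 2 / 2)).
  by rewrite /tilt /c -expRD; congr expR; ring.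
by rewrite ler_pM2l ?expR_gt0// expR_ge1Dx.
Qed.

End lower_bound.

End likelihood_ratio.

(** * Averages over subsets of given size *)

Section subset_counting.

(** Equality holds at [p = q]. Going from [p] to [p.+1], after multiplication by [p.+1 - k], brings
    a factor [n - s - (p - k)] on the left and [n - p] on the right; the former is smaller because
    [k <= s]. *)
Lemma bin_hypergeometric_le n s p q k :
  (k <= s)%N -> (k <= q)%N -> (q <= p <= n)%N ->
  ('C(n - s, p - k) * ('C(n, q) * 'C(q, k)) <=
   'C(p, k) * ('C(n - s, q - k) * 'C(n, p)))%N.
Proof.
move=> ks kq /andP[]; elim: p => [|p IHp].
  by rewrite leqn0 => /eqP -> _; rewrite [leqLHS]mulnA [leqLHS]mulnC.
rewrite leq_eqVlt => /orP[/eqP <-|qp] pn.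
  by rewrite [leqLHS]mulnA [leqLHS]mulnC.
have kp : (k <= p)%N by exact: leq_trans kq _.
have := IHp qp (ltnW pn).
set E := ('C(n - s, q - k))%N; set F := ('C(n, q) * 'C(q, k))%N => {}IHp.
have d0 : (0 < p.+1 - k)%N by rewrite subn_gt0 ltnS.
rewrite -(leq_pmul2l d0).
have e1 : ((p.+1 - k) * 'C(n - s, p.+1 - k) =
    (n - s - (p - k)) * 'C(n - s, p - k))%N.
  by rewrite subSn// mul_bin_left.
have e2 : ((p.+1 - k) * 'C(p.+1, k) = p.+1 * 'C(p, k))%N by rewrite -mul_bin_down.
have e3 : (p.+1 * 'C(n, p.+1) = (n - p) * 'C(n, p))%N by rewrite mul_bin_left.
rewrite mulnA e1 mulnA e2.
have -> : (p.+1 * 'C(p, k) * (E * 'C(n, p.+1)) =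
    (n - p) * ('C(p, k) * (E * 'C(n, p))))%N.
  by rewrite -mulnA mulnCA (mulnCA p.+1) e3 !(mulnCA (n - p)%N).
rewrite -mulnA; apply: leq_mul => //; lia.
Qed.

(** These sets are the [U :|: V] with [V] of size [p - #|U|] in the complement of [A]. *)
Lemma card_subsets_with_trace (T : finType) (A U : {set T}) p :
  U \subset A -> (#|U| <= p)%N ->
  #|[set S : {set T} | (#|S| == p) && (S :&: A == U)]%SET| =
  'C(#|T| - #|A|, p - #|U|).
Proof.
move=> UA Up.
have AC : #|~: A| = (#|T| - #|A|)%N by rewrite cardsCs finset.setCK.
rewrite -AC -cards_draws.
rewrite -(@card_in_imset _ _ (fun V => U :|: V)
  [set V : {set T} | V \subset ~: A & #|V| == p - #|U|]%SET)%N; last first.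
  move=> V W /[!inE] /andP[VA _] /andP[WA _] /(congr1 (fun B => B :\: A)).
  rewrite !finset.setDUl (_ : U :\: A = finset.set0); last first.
    by apply/eqP; rewrite finset.setD_eq0.
  rewrite !finset.set0U !finset.setDE.
  by move/finset.setIidPl : VA => ->; move/finset.setIidPl : WA => ->.
apply: eq_card => S; rewrite inE; apply/idP/imsetP.
- move=> /andP[/eqP Sp /eqP SA]; exists (S :\: A).
    rewrite inE finset.setDE finset.subsetIr/= -finset.setDE.
    by rewrite cardsD Sp SA.
  by rewrite -SA finset.setID.
- move=> [V]; rewrite inE => /andP[VA /eqP Vp] ->; apply/andP; split.
    rewrite cardsU Vp (_ : U :&: V = finset.set0) ?cards0 ?subn0 ?subnKC//.
    apply/eqP; rewrite finset.setI_eq0; apply: (disjointWl UA).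
    by rewrite disjoint_sym finset.disjoints_subset.
  rewrite finset.setIUl (finset.setIidPl UA).
  rewrite (_ : V :&: A = finset.set0) ?finset.setU0//.
  by apply/eqP; rewrite finset.setI_eq0 finset.disjoints_subset.
Qed.

(** ['C(p, k) * t ^+ k] is one term of the binomial expansion of [(1 + t) ^+ p]. A small [t] keeps
    the growth in [p] below a given geometric decrease. *)
Lemma bin_le_expr (R : realFieldType) (t : R) p k : 0 < t ->
  'C(p, k)%:R <= t ^- k * (1 + t) ^+ p.
Proof.
move=> t0; have [pk|kp] := ltnP p k.
  by rewrite bin_small// mulr_ge0 ?invr_ge0 ?exprn_ge0 ?addr_ge0// ltW.
rewrite ler_pdivlMl ?exprn_gt0// exprDn.
have kp' : (k < p.+1)%N by [].
rewrite (bigD1 (Ordinal kp'))//= expr1n mul1r mulr_natr lerDl.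
by apply: sumr_ge0 => i _; rewrite mulrn_wge0// expr1n mul1r exprn_ge0// ltW.
Qed.

(* For a uniformly drawn set [S] of size [m] the trace [S :&: A] is a fixed set of
   size [k] with hypergeometric probability; the ratio of these probabilities
   for [m = p] and [m = q] is at most ['C(p, k) <= t ^- k * (1 + t) ^+ p]. *)
Lemma mean_trace_le (R : realFieldType) n p q (A : {set 'I_n})
    (a : {set 'I_n} -> R) (t : R) :
  (forall U, 0 <= a U) -> (#|A| <= q)%N -> (q <= p <= n)%N -> 0 < t <= 1 ->
  'C(n, p)%:R^-1 * \sum_(S : {set 'I_n} | #|S| == p) a (S :&: A) <=
  t ^- q * (1 + t) ^+ p *
  ('C(n, q)%:R^-1 * \sum_(S : {set 'I_n} | #|S| == q) a (S :&: A)).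
Proof.
move=> a0 Aq /[dup] qpn /andP[qp pn] /andP[t0 t1].
(* Sorting the sets by their trace [U] reduces the claim to a comparison of weights for each [U]. *)
have traceE m : (q <= m)%N ->
    \sum_(S : {set 'I_n} | #|S| == m) a (S :&: A) =
    \sum_(U : {set 'I_n} | U \subset A) 'C(n - #|A|, m - #|U|)%:R * a U.
  move=> qm.
  rewrite (partition_big (fun S => S :&: A) (fun U => U \subset A))/=; last first.
    by move=> S _; exact: finset.subsetIr.
  apply: eq_bigr => U UA; rewrite (eq_bigr (fun=> a U)); last first.
    by move=> S /andP[_ /eqP ->].
  have Um : (#|U| <= m)%N.
    by rewrite (leq_trans (subset_leq_card UA))// (leq_trans Aq).
  rewrite sumr_const -[LHS]mulr_natl; congr (_%:R * _).
  have := card_subsets_with_trace UA Um; rewrite card_ord => <-.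
  by apply: eq_card => S; rewrite inE.
rewrite !traceE// !mulr_sumr; apply: ler_sum => U UA.
have UAc := subset_leq_card UA.
have Uq : (#|U| <= q)%N by exact: leq_trans Aq.
rewrite !mulrA ler_wpM2r//.
have Cp : 0 < 'C(n, p)%:R :> R by rewrite ltr0n bin_gt0.
have Cq : 0 < 'C(n, q)%:R :> R by rewrite ltr0n bin_gt0 (leq_trans qp).
rewrite ler_pdivrMl//.
have hyp := bin_hypergeometric_le UAc Uq qpn.
(* The factor ['C(q, #|U|)], at least 1, is dropped. *)
have {}hyp : ('C(n - #|A|, p - #|U|) * 'C(n, q) <=
    'C(p, #|U|) * ('C(n - #|A|, q - #|U|) * 'C(n, p)))%N.
  by apply: leq_trans hyp; rewrite leq_mul// leq_pmulr// bin_gt0.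
rewrite -(ler_nat R) !natrM -ler_pdivlMr// in hyp.
apply: le_trans hyp _.
rewrite [X in _ <= X](_ : _ = t ^- q * (1 + t) ^+ p *
  ('C(n - #|A|, q - #|U|)%:R * 'C(n, p)%:R) / 'C(n, q)%:R); last by ring.
rewrite ler_wpM2r ?invr_ge0 ?ler0n// ler_wpM2r ?mulr_ge0 ?ler0n//.
apply: le_trans (bin_le_expr _ _ t0) _.
rewrite ler_wpM2r ?exprn_ge0 ?addr_ge0 ?(ltW t0)//.
rewrite lef_pV2 ?posrE ?exprn_gt0//.
by apply: ler_wiXn2l => //; exact: ltW.
Qed.

End subset_counting.

(** * The posterior mass of large models *)

Section posterior_bound.
Context (R : realType) (n : nat) (w : dim_prior R n)
  (gS : forall S : {set 'I_n}, prob_density (lebesgue_tuple R #|S|))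
  (g : prob_density (@lebesgue_measure R)).
Hypothesis gSE : forall (S : {set 'I_n}) (x : #|S|.-tuple R),
  gS S x = \prod_(i < #|S|) g (tnth x i).

Implicit Types (S : {set 'I_n}) (x : n.-tuple R).

(* The marginal likelihood of the model [S], relative to the empty model. *)
Definition evidence S x : R := \prod_(i in S) marginal_ratio g (tnth x i).

(** Likelihood of the empty model, the common factor that cancels in the posterior. *)
Let std_pdf x : R := \prod_(i < n) normal_pdf 0 1 (tnth x i).

Lemma evidence_ge0 S x : 0 <= evidence S x.
Proof. by apply: prodr_ge0 => i _; exact: marginal_ratio_ge0. Qed.

Lemma measurable_evidence S : measurable_fun setT (evidence S).
Proof.
rewrite /evidence (_ : (fun x => _) = fun x : n.-tuple R =>
  \prod_(i < n) (if i \in S then marginal_ratio g (tnth x i) else 1)); last first.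
  by apply/funext => x; rewrite big_mkcond.
apply: (measurable_prod_tnth (f := fun i t =>
  if i \in S then marginal_ratio g t else 1)) => i.
by case: (i \in S) => //; exact: measurable_marginal_ratio.
Qed.

Let std_pdf_gt0 x : 0 < std_pdf x.
Proof.
apply: prodr_gt0 => i _; rewrite normal_pdfE//.
by rewrite mulr_gt0 ?normal_peak_gt0 ?expR_gt0.
Qed.

Lemma tnth_embed_enum_val S (y : #|S|.-tuple R) (j : 'I_#|S|) :
  tnth (embed y) (enum_val j) = tnth y j.
Proof.
rewrite tnth_mktuple enum_valP (tnth_nth 0); congr nth.
by rewrite /enum_val index_uniq ?enum_uniq// -cardE.
Qed.

Lemma supp_embed S (y : #|S|.-tuple R) : supp (embed y) \subset S.
Proof.
apply/fintype.subsetP => i; rewrite inE tnth_mktuple.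
by case: ifPn => //; rewrite eqxx.
Qed.

Let gauss_pdf_embed S (y : #|S|.-tuple R) x :
  gauss_pdf (embed y) x =
  std_pdf x * \prod_(j < #|S|) tilt (tnth x (enum_val j)) (tnth y j).
Proof.
rewrite /gauss_pdf; under eq_bigr do rewrite normal_pdf_tilt.
rewrite big_split/=; congr (_ * _).
under [RHS]eq_bigr do rewrite -tnth_embed_enum_val.
rewrite -(big_enum_val (fun i => tilt (tnth x i) (tnth (embed y) i)))/=.
rewrite [RHS]big_mkcond/=; apply: eq_bigr => i _.
by case: ifPn => // iS; rewrite tnth_mktuple (negbTE iS) tiltx0.
Qed.

Let measurable_gauss_pdf_mean x :
  measurable_fun setT (fun theta : n.-tuple R => gauss_pdf theta x).
Proof.
apply: (measurable_prod_tnth (f := fun i t => normal_pdf t 1 (tnth x i))) => i.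
rewrite (_ : (fun t => _) =
  fun t => normal_pdf 0 1 (tnth x i) * tilt (tnth x i) t).
  by apply: measurable_funM => //; exact: measurable_tilt2.
by apply/funext => t; rewrite normal_pdf_tilt.
Qed.

(** Off [S] the mean is zero and [tilt] equals 1; on [S] the product density splits the integral
    into one-dimensional ones. *)
Lemma integral_gauss_pdf_embed S x :
  (\int[density_law (gS S)]_y (gauss_pdf (embed y) x)%:E =
   (std_pdf x * evidence S x)%:E)%E.
Proof.
rewrite ge0_integral_density; last 2 first.
- apply/measurable_EFinP; apply: (measurableT_comp (measurable_gauss_pdf_mean x)).
  exact: measurable_embed.
- by move=> y; rewrite lee_fin gauss_pdf_ge0.
pose f (j : 'I_#|S|) t := tilt (tnth x (enum_val j)) t * g t.
have f0 j t : 0 <= f j t by rewrite mulr_ge0 ?tilt_ge0 ?pdf_ge0.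
have mf j : measurable_fun setT (f j).
  by apply: measurable_funM; [exact: measurable_tilt2|exact: (measurable_pdf g)].
rewrite (eq_integral (fun y : #|S|.-tuple R =>
    (std_pdf x)%:E * (\prod_(j < #|S|) f j (tnth y j))%:E)%E); last first.
  move=> y _; rewrite gSE gauss_pdf_embed -!EFinM; congr EFin.
  by rewrite mulrCA big_split/= [X in _ * X]mulrC.
rewrite ge0_integralZl//; last 3 first.
- by apply/measurable_EFinP; exact: (measurable_prod_tnth (f := f)).
- by move=> y _; rewrite lee_fin prodr_ge0.
- by rewrite lee_fin ltW.
rewrite (integral_prod_tnth
  (a := fun j => marginal_ratio g (tnth x (enum_val j))))//.
  rewrite -EFinM; congr (_ * _)%:E.
  by rewrite /evidence (big_enum_val (A := mem S)).
by move=> j; exact: integral_tilt.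
Qed.

Lemma card_suppE (theta : n.-tuple R) :
  #|supp theta|%:R = \sum_(i < n) \1_(~` [set 0]) (tnth theta i) :> R.
Proof.
rewrite -sum1_card natr_sum big_mkcond/=; apply: eq_bigr => i _.
rewrite indicE inE; case: ifPn => [t0|/negbNE/eqP t0].
  by rewrite mem_set//=; exact/eqP.
by rewrite memNset//=; apply.
Qed.

Lemma measurable_card_supp (c : R) :
  measurable [set theta : n.-tuple R | c < #|supp theta|%:R].
Proof.
pose F (theta : n.-tuple R) : R := \sum_(i < n) \1_(~` [set 0]) (tnth theta i).
have mF : measurable_fun setT F.
  apply: measurable_sum => i.
  apply: (@measurableT_comp _ _ _ _ _ _ (\1_(~` [set 0]) : R -> R)).
    by apply: measurable_indic; apply: measurableC; exact: measurable_set1.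
  exact: measurable_tnth.
rewrite (_ : [set _ | _] = setT `&` F @^-1` `]c, +oo[).
  by apply: mF => //; exact: measurable_itv.
by rewrite setTI; apply/seteqP; split => theta/=;
  rewrite card_suppE in_itv/= andbT.
Qed.

Let sum_evidence_gt0 x :
  0 < \sum_(S : {set 'I_n}) model_weight w S * evidence S x.
Proof.
rewrite (bigD1 finset.set0)//= ltr_wpDr//; last first.
  by rewrite mulr_gt0 ?model_weight_gt0// /evidence big_set0.
apply: sumr_ge0 => S _.
by rewrite mulr_ge0 ?evidence_ge0 ?ltW ?model_weight_gt0.
Qed.

(** A vector drawn in the model [S] has its support inside [S], so only models larger than [c]
    charge the event. This is a bound only, since drawn coordinates may vanish. *)
Lemma posterior_le x (c : R) :
  posterior (prior w gS) x [set theta | c < #|supp theta|%:R] <=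
  (\sum_(S : {set 'I_n} | c < #|S|%:R) model_weight w S * evidence S x) /
  (\sum_(S : {set 'I_n}) model_weight w S * evidence S x).
Proof.
rewrite /posterior; set B := [set theta : n.-tuple R | _].
have mB : measurable B by exact: measurable_card_supp.
have mw0 S : (0 <= (model_weight w S)%:E)%E.
  by rewrite lee_fin ltW// model_weight_gt0.
have pdf0 theta : (0 <= (gauss_pdf theta x)%:E)%E by rewrite lee_fin gauss_pdf_ge0.
have mpdf : measurable_fun setT (fun theta : n.-tuple R => (gauss_pdf theta x)%:E).
  exact/measurable_EFinP.
have -> : \int[prior w gS]_theta gauss_pdf theta x =
    std_pdf x * \sum_(S : {set 'I_n}) model_weight w S * evidence S x.
  rewrite /Rintegral ge0_integral_prior//.
  under eq_bigr do rewrite integral_gauss_pdf_embed -EFinM.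
  rewrite sumEFin/= mulr_sumr; apply: eq_bigr => S _; exact: mulrCA.
rewrite ler_pdivrMr ?mulr_gt0// mulrCA divfK ?gt_eqF//.
have numE : (\int[prior w gS]_(theta in B) (gauss_pdf theta x)%:E <=
    (std_pdf x * \sum_(S : {set 'I_n} | (c < #|S|%:R)%R)
      model_weight w S * evidence S x)%:E)%E.
  rewrite integral_mkcond ge0_integral_prior; last 2 first.
  - by apply/(measurable_restrictT _ _).1 => //; exact: measurable_funTS.
  - by move=> theta; rewrite patchE; case: ifPn.
  rewrite [leRHS](_ : _ = \sum_(S : {set 'I_n} | (c < #|S|%:R)%R)
      (model_weight w S)%:E *
      \int[density_law (gS S)]_y (gauss_pdf (embed y) x)%:E)%E;
    last first.
    under [RHS]eq_bigr do rewrite integral_gauss_pdf_embed -EFinM.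
    by rewrite sumEFin mulr_sumr; congr EFin; apply: eq_bigr => S _; exact: mulrCA.
  rewrite [leRHS]big_mkcond; apply: lee_sum => S _; case: ifPn => [cS|/negP cS].
    rewrite lee_wpmul2l//; apply: ge0_le_integralT => y;
      by rewrite patchE; case: ifPn.
  rewrite integral0_eq ?mule0// => y _; rewrite patchE memNset// => /= Sy.
  apply: cS; apply: lt_le_trans Sy _.
  by rewrite ler_nat; exact: subset_leq_card (supp_embed y).
rewrite /Rintegral -lee_fin fineK//.
rewrite ge0_fin_numE; first exact: le_lt_trans numE (ltry _).
exact: integral_ge0.
Qed.

End posterior_bound.

(** * Expected posterior mass under the law of the data *)

Section posterior_expectation.
Context (R : realType) (n : nat) (w : dim_prior R n)
  (gS : forall S : {set 'I_n}, prob_density (lebesgue_tuple R #|S|))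
  (g : prob_density (@lebesgue_measure R)).
Hypothesis gSE : forall (S : {set 'I_n}) (x : #|S|.-tuple R),
  gS S x = \prod_(i < #|S|) g (tnth x i).

Definition normal_density (m : R) : prob_density (@lebesgue_measure R) :=
  @ProbDensity _ _ _ lebesgue_measure (normal_pdf m 1)
    (measurable_normal_pdf m 1) (normal_pdf_ge0 m 1) (integral_normal_pdf m 1).

Lemma evidence_split (A S : {set 'I_n}) (x : n.-tuple R) :
  evidence g S x = evidence g (S :&: A) x * evidence g (S :\: A) x.
Proof. by rewrite /evidence (big_setID A). Qed.

Lemma evidence_invariant (A : {set 'I_n}) (x y : n.-tuple R) :
  (forall i, i \in A -> tnth x i = tnth y i) -> evidence g A x = evidence g A y.
Proof. by move=> xy; apply: eq_bigr => i iA; rewrite xy. Qed.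

(* Off [supp theta] the factor [marginal_ratio g] turns the standard normal
   density into [marginal_density g], which is again a probability density. *)
Lemma expectation_evidence (theta : n.-tuple R) (A S : {set 'I_n})
    (h : n.-tuple R -> R) :
  supp theta \subset A -> measurable_fun setT h -> (forall x, 0 <= h x) ->
  (forall x y, (forall i, i \in A -> tnth x i = tnth y i) -> h x = h y) ->
  (\int[gauss_law theta]_x (evidence g S x * h x)%:E =
   \int[gauss_law theta]_x (evidence g (S :&: A) x * h x)%:E)%E.
Proof.
move=> thetaA mh h0 hA.
have mev U : measurable_fun setT (fun x => (evidence g U x * h x)%:E).
  by apply/measurable_EFinP/measurable_funM => //; exact: measurable_evidence.
have ev0 U x : (0 <= (evidence g U x * h x)%:E)%E.
  by rewrite lee_fin mulr_ge0 ?evidence_ge0.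
rewrite !ge0_integral_density//.
(* The evidence of [S :\: A] is absorbed into the densities of those coordinates, where [theta]
   vanishes. *)
pose f i := if i \in S :\: A then marginal_density g
  else normal_density (tnth theta i).
pose f' i := normal_density (tnth theta i).
transitivity (\int[lebesgue_tuple R n]_x
    ((\prod_(i < n) f i (tnth x i))%:E * (evidence g (S :&: A) x * h x)%:E))%E.
  apply: eq_integral => x _; rewrite -!EFinM; congr EFin.
  have -> : \prod_(i < n) f i (tnth x i) =
      gauss_pdf theta x * evidence g (S :\: A) x.
    rewrite /gauss_pdf /evidence [X in _ * X]big_mkcond/= -big_split/=.
    apply: eq_bigr => i _; rewrite /f; case: ifPn => iSA; last by rewrite mulr1.
    suff -> : tnth theta i = 0 by [].
    apply/eqP; move: iSA; rewrite inE => /andP[+ _]; apply: contraNT => ti.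
    by apply: (fintype.subsetP thetaA); rewrite inE.
  by rewrite /= (evidence_split A S); ring.
(* The remaining integrand ignores the coordinates in [S :\: A], so their normal densities can be
   restored. *)
rewrite (eq_integral_prod_density (f' := f'))// => i.
have [iSA|iSA] := boolP (i \in S :\: A); last first.
  by left => x; rewrite /f (negbTE iSA).
right => x y xy; have {}xy j : j \in A -> tnth x j = tnth y j.
  move=> jA; apply: xy; apply: contraTneq iSA => <-.
  by rewrite inE jA.
by rewrite (hA x y)// (evidence_invariant (x := x) (y := y))// => j /setIP[_ /xy].
Qed.

Hypothesis mean0 : (\int[lebesgue_measure]_x (x * g x)%:E = 0)%E.
Hypothesis var_fin : (\int[lebesgue_measure]_x (x ^+ 2 * g x)%:E < +oo)%E.

Let kappa : R := expR (- ((\int[lebesgue_measure]_x (x ^+ 2 * g x)) / 2)).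

Let kappa_gt0 : 0 < kappa. Proof. exact: expR_gt0. Qed.

Let kappa_le1 : kappa <= 1.
Proof.
rewrite -expR0 ler_expR oppr_le0 divr_ge0//.
by apply: Rintegral_ge0 => x _; rewrite mulr_ge0 ?sqr_ge0 ?pdf_ge0.
Qed.

Lemma evidence_ge (S : {set 'I_n}) (x : n.-tuple R) :
  kappa ^+ #|S| <= evidence g S x.
Proof.
rewrite -prodr_const; apply: ler_prod => i _.
by rewrite ltW ?kappa_gt0//=; exact: marginal_ratio_ge.
Qed.

Lemma sum_evidence_ge (A : {set 'I_n}) q (x : n.-tuple R) : (q <= n)%N ->
  w q / 'C(n, q)%:R * (kappa ^+ q *
    \sum_(S : {set 'I_n} | #|S| == q) evidence g (S :&: A) x) <=
  \sum_(S : {set 'I_n}) model_weight w S * evidence g S x.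
Proof.
move=> qn; rewrite [leRHS](bigID (fun S : {set 'I_n} => #|S| == q))/=.
apply: ler_wpDr.
  apply: sumr_ge0 => S _.
  by rewrite mulr_ge0 ?evidence_ge0// ltW// model_weight_gt0.
rewrite !mulr_sumr; apply: ler_sum => S /eqP Sq.
have w0 : 0 <= w q / 'C(n, q)%:R by rewrite divr_ge0// ltW// dim_pmf_gt0.
rewrite /model_weight Sq ler_wpM2l//.
rewrite (evidence_split A S) mulrC ler_wpM2l ?evidence_ge0//.
apply: le_trans (evidence_ge _ _).
(* [S :\: A] has at most [q] elements and [kappa <= 1]. *)
apply: ler_wiXn2l => //; first exact: ltW.
by rewrite -Sq subset_leq_card// finset.subsetDl.
Qed.

(** For the models of size [m], iterating the decrease of [w] from [m] down to [q] gives
    [D ^+ (m - q)], and [mean_trace_le] gives the factor in [t]. *)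
Lemma sum_trace_evidence_le (A : {set 'I_n}) q (x : n.-tuple R) (c t D : R) :
  (#|A| <= q <= n)%N -> (forall m, c < m%:R -> (q < m)%N) ->
  (forall m, (q < m <= n)%N -> w m <= D * w m.-1) -> 0 < D -> 0 < t <= 1 ->
  \sum_(S : {set 'I_n} | c < #|S|%:R) model_weight w S * evidence g (S :&: A) x <=
  (\sum_(m < n.+1 | c < m%:R) D ^+ (m - q) * (t ^- q * (1 + t) ^+ m)) *
  (w q / 'C(n, q)%:R *
    \sum_(S : {set 'I_n} | #|S| == q) evidence g (S :&: A) x).
Proof.
move=> /andP[Aq qn] cq wD D0 t01.
have wq m : (q <= m <= n)%N -> w m <= D ^+ (m - q) * w q.
  elim: m => [|m IHm].
    by rewrite leqn0 => /andP[/eqP -> _]; rewrite subnn mul1r.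
  move=> /andP[]; rewrite leq_eqVlt => /orP[/eqP <- _|qm mn].
    by rewrite subnn mul1r.
  apply: le_trans (wD _ _) _; first by rewrite qm.
  by rewrite /= subSn// exprS -mulrA ler_pM2l// IHm// -ltnS qm ltnW.
rewrite (partition_big (fun S : {set 'I_n} => inord #|S| : 'I_n.+1)
  (fun m => c < m%:R))/=; last first.
  by move=> S cS; rewrite inordK// ltnS card_set_ord.
rewrite mulr_suml; apply: ler_sum => m cm.
have mn : (m <= n)%N by rewrite -ltnS.
rewrite (eq_big (fun S : {set 'I_n} => #|S| == m)
  (fun S => w m / 'C(n, m)%:R * evidence g (S :&: A) x)); last 2 first.
- move=> S; apply/andP/eqP => [[_ /eqP <-]|Sm].
    by rewrite inordK// ltnS card_set_ord.
  by rewrite Sm inord_val eqxx.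
- by move=> S /andP[_ /eqP <-]; rewrite /model_weight inordK// ltnS card_set_ord.
rewrite -mulr_sumr -mulrA.
have qm : (q <= m)%N by rewrite ltnW// cq.
set V := \sum_(S : {set _} | #|S| == q) _.
have V0 : 0 <= V by apply: sumr_ge0 => S _; exact: evidence_ge0.
have := @mean_trace_le R n m q A (fun U => evidence g U x) t.
move=> /(_ (fun U => evidence_ge0 _ _ _) Aq _ t01); rewrite qm mn => /(_ isT) tr.
apply: le_trans (ler_wpM2l _ tr) _; first by rewrite ltW// dim_pmf_gt0.
rewrite [leRHS](_ : _ = D ^+ (m - q) * w q *
  (t ^- q * (1 + t) ^+ m * ('C(n, q)%:R^-1 * V))); last by ring.
case/andP: t01 => t0 t1.
rewrite ler_wpM2r ?wq ?qm//.
by rewrite !mulr_ge0 ?invr_ge0 ?exprn_ge0 ?addr_ge0// ltW.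
Qed.

Lemma expectation_posterior_le (theta : n.-tuple R) q (c t D : R) :
  (#|supp theta| <= q)%N -> (forall m, c < m%:R -> (q < m)%N) ->
  (forall m, (q < m <= n)%N -> w m <= D * w m.-1) -> 0 < D -> 0 < t <= 1 ->
  (\int[gauss_law theta]_x
    (posterior (prior w gS) x [set eta | c < #|supp eta|%:R])%:E <=
  (kappa ^- q * \sum_(m < n.+1 | c < m%:R)
    D ^+ (m - q) * (t ^- q * (1 + t) ^+ m))%:E)%E.
Proof.
set A := supp theta => Aq cq wD D0 t01.
have K0 : 0 <= \sum_(m < n.+1 | c < m%:R) D ^+ (m - q) * (t ^- q * (1 + t) ^+ m).
  case/andP: t01 => t0 t1; apply: sumr_ge0 => m _.
  by rewrite !mulr_ge0 ?invr_ge0 ?exprn_ge0 ?addr_ge0 ?(ltW t0) ?(ltW D0).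
have post0 x : (0 <= (posterior (prior w gS) x [set eta | c < #|supp eta|%:R])%:E)%E.
  by rewrite lee_fin divr_ge0//; apply: Rintegral_ge0 => eta _; exact: gauss_pdf_ge0.
(* If [n < q], no model is larger than [c] and the posterior mass is zero. *)
have [nq|qn] := ltnP n q.
  rewrite integral0_eq ?lee_fin ?mulr_ge0 ?invr_ge0 ?exprn_ge0 ?(ltW kappa_gt0)//.
  move=> x _; apply/eqP; rewrite eq_le post0 andbT lee_fin.
  apply: le_trans (posterior_le w gSE x c) _; rewrite big_pred0 ?mul0r//.
  move=> S; apply/negbTE/negP => /cq qS.
  by have := leq_trans (ltn_trans nq qS) (card_set_ord S); rewrite ltnn.
pose V x := \sum_(S : {set 'I_n} | #|S| == q) evidence g (S :&: A) x.
have V_gt0 x : 0 < V x.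
  have [S Sq] : exists S : {set 'I_n}, #|S| == q.
    have : (0 < #|[set S : {set 'I_n} | #|S| == q]%SET|)%N.
      by rewrite card_draws card_ord bin_gt0.
    by rewrite card_gt0 => /set0Pn[S]; rewrite inE => Sq; exists S.
  rewrite /V (bigD1 S)//= ltr_wpDr//.
    by apply: sumr_ge0 => U _; exact: evidence_ge0.
  by apply: lt_le_trans (evidence_ge _ _); rewrite exprn_gt0.
pose b := w q / 'C(n, q)%:R.
have b0 : 0 < b by rewrite divr_gt0 ?dim_pmf_gt0// ltr0n bin_gt0.
(* Reciprocal of the lower bound [sum_evidence_ge] for the denominator; it depends on the
   coordinates in [A] alone, as [expectation_evidence] requires. *)
pose h x := (b * (kappa ^+ q * V x))^-1.
have bV_gt0 x : 0 < b * (kappa ^+ q * V x).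
  by rewrite mulr_gt0// mulr_gt0// exprn_gt0.
have h0 x : 0 <= h x by rewrite invr_ge0 ltW.
have mV : measurable_fun setT V.
  rewrite /V; under eq_fun do rewrite -big_filter.
  by apply: measurable_sum => S; exact: measurable_evidence.
have mh : measurable_fun setT h.
  rewrite (_ : h = fun x => (b * (kappa ^+ q * V x)) `^ (-1)); last first.
    by apply/funext => x; rewrite powR_inv1// ltW.
  apply: (measurableT_comp (measurable_powR (-1))).
  by do 2 apply: measurable_funM => //.
have hA x y : (forall i, i \in A -> tnth x i = tnth y i) -> h x = h y.
  move=> xy; congr (_ * (_ * _))^-1; apply: eq_bigr => S _.
  by apply: evidence_invariant => i /setIP[_ /xy].
have aw0 S : 0 <= model_weight w S by rewrite ltW// model_weight_gt0.
have mev U : measurable_fun setT (fun x => (evidence g U x * h x)%:E).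
  by apply/measurable_EFinP/measurable_funM => //; exact: measurable_evidence.
have ev0 U x : (0 <= (evidence g U x * h x)%:E)%E.
  by rewrite lee_fin mulr_ge0 ?evidence_ge0.
(* Used twice: with [E] the identity, then with the trace on [A]. *)
have sumE (E : {set 'I_n} -> {set 'I_n}) :
    (\int[gauss_law theta]_x (\sum_(S : {set 'I_n} | (c < #|S|%:R)%R)
       model_weight w S * (evidence g (E S) x * h x))%:E =
     \sum_(S : {set 'I_n} | (c < #|S|%:R)%R) (model_weight w S)%:E *
       \int[gauss_law theta]_x (evidence g (E S) x * h x)%:E)%E.
  under eq_integral => x _ do rewrite -sumEFin big_mkcond/=.
  rewrite (ge0_integral_sum _ measurableT
    (f := fun (S : {set 'I_n}) x => if (c < #|S|%:R)%R then
       (model_weight w S * (evidence g (E S) x * h x))%:E else 0%E))//; last 2 first.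
  - move=> S; case: (c < _) => //; under eq_fun do rewrite EFinM.
    exact: measurable_funeM.
  - by move=> S x _; case: ifP => // _; rewrite EFinM mule_ge0// lee_fin.
  rewrite [RHS]big_mkcond; apply: eq_bigr => S _; case: ifP => _.
    by under eq_integral do rewrite EFinM; rewrite ge0_integralZl// lee_fin.
  by rewrite integral0_eq.
apply: (@le_trans _ _ (\int[gauss_law theta]_x
    (\sum_(S : {set 'I_n} | (c < #|S|%:R)%R)
       model_weight w S * (evidence g S x * h x))%:E)%E).
  apply: ge0_le_integralT => // x; rewrite lee_fin.
  apply: le_trans (posterior_le w gSE x c) _.
  rewrite mulr_suml; apply: ler_sum => S _; rewrite -mulrA.
  rewrite ler_wpM2l// ler_wpM2l ?evidence_ge0//.
  have le_den := sum_evidence_ge A x qn.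
  by rewrite lef_pV2 ?posrE// (lt_le_trans (bV_gt0 x)).
rewrite (sumE id) (eq_bigr (fun S => (model_weight w S)%:E *
  \int[gauss_law theta]_x (evidence g (S :&: A) x * h x)%:E)%E); last first.
  by move=> S _; congr (_ * _)%E; exact: expectation_evidence.
rewrite -sumE; set K := \sum_(m < n.+1 | _) _ in K0 *.
(* Once only traces remain, [h] cancels [b * V x] and the integrand is bounded by a constant. *)
apply: (@le_trans _ _ (\int[gauss_law theta]_x (kappa ^- q * K)%:E)%E).
  apply: ge0_le_integralT => x; rewrite lee_fin.
    by apply: sumr_ge0 => S _; rewrite mulr_ge0 ?aw0 ?mulr_ge0 ?evidence_ge0 ?h0.
  under eq_bigr do rewrite mulrA.
  rewrite -mulr_suml ler_pdivrMr ?bV_gt0//.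
  rewrite [leRHS](_ : _ = K * (b * V x)).
    by apply: sum_trace_evidence_le => //; rewrite Aq.
  by field; rewrite expf_eq0 negb_and gt_eqF// orbT.
rewrite -[X in integral _ _ X]/(cst (kappa ^- q * K)%:E) integral_cst//.
by rewrite [X in (_ * X)%E](probability_setT (gauss_law theta)) mule1.
Qed.

End posterior_expectation.

(** * Geometric tail, choice of the constants and conclusion *)

Lemma geometric_tail_le (R : realFieldType) (r : R) N k : 0 <= r <= 1 ->
  (1 - r) * \sum_(m < k | (N < m)%N) r ^+ m <= r ^+ N.
Proof.
move=> /andP[r0 r1].
(* The subtracted term makes the induction telescope; [maxn] covers [k <= N], where the sum is
   empty. *)
suff : (1 - r) * \sum_(m < k | (N < m)%N) r ^+ m <= r ^+ N - r ^+ maxn N k.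
  by move/le_trans; apply; rewrite gerBl exprn_ge0.
elim: k => [|k IHk]; first by rewrite big_ord0 mulr0 maxn0 subrr.
rewrite big_mkcond/= big_ord_recr/= -big_mkcond/=; case: ltnP => Nk.
  rewrite (maxn_idPr (ltnW (ltnW Nk : (N < k.+1)%N))).
  rewrite (maxn_idPr (ltnW Nk)) in IHk.
  by rewrite exprS; move: IHk; lra.
rewrite addr0 (le_trans IHk)// lerD2l lerN2; apply: ler_wiXn2l => //.
by rewrite geq_max leq_maxl/= (leq_trans (leqnSn k))// leq_maxr.
Qed.

Theorem theorem2p1 (R : realType) (p : nat -> nat)
    (w : forall n : nat, dim_prior R n)
    (gS : forall (n : nat) (S : {set 'I_n}),
       prob_density (lebesgue_tuple R #|S|))
    (g : prob_density (@lebesgue_measure R)) :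
  (forall n : nat, (0 < n)%N -> (1 <= p n <= n)%N) ->
  exponential_decrease p w ->
  (forall (n : nat) (S : {set 'I_n}) (x : #|S|.-tuple R),
     gS n S x = \prod_(i < #|S|) g (tnth x i)) ->
  (\int[lebesgue_measure]_x (x * g x)%:E = 0)%E ->
  (\int[lebesgue_measure]_x (x ^+ 2 * g x)%:E < +oo)%E ->
  p n @[n --> \oo] --> \oo ->
  exists M : R, 0 < M /\
    ereal_sup [set 'E_(gauss_law theta0)[fun X =>
        posterior (prior (w n) (gS n)) X
          [set theta | (M * (p n)%:R < (#|supp theta|)%:R)%R]]%E
      | theta0 in @l0_ball R n (p n)] @[n --> \oo] --> 0%E.
Proof.
move=> _ [C [D0 [C0 D01 decr]]] gSE mean0 var_fin p_oo.
(* An integer above [C]: past the size [A * p n] the weights decrease. *)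
pose A := (Num.truncn C).+1.
have CA : C <= A%:R by rewrite ltW// truncnS_gt.
(* [D0] may be small or negative; the floor 1/2 ensures [D > 0] and [t <= 1]. *)
pose D := Num.max D0 2^-1.
have D_lb : 2^-1 <= D by rewrite le_max lexx orbT.
have D1 : D < 1 by rewrite gt_max D01/= invf_lt1// ltr1n.
have D_gt0 : 0 < D by apply: lt_le_trans D_lb; rewrite invr_gt0.
(* Chosen so that [D * (1 + t)] is the midpoint of [D] and 1, hence still below 1. *)
pose t := (1 - D) / (2 * D).
have t01 : 0 < t <= 1.
  rewrite divr_gt0 ?subr_gt0 ?mulr_gt0//= ler_pdivrMr ?mulr_gt0// mul1r.
  by lra.
have tE : D * (1 + t) = (1 + D) / 2 by rewrite /t; field; rewrite gt_eqF.
clearbody t.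
pose r := D * (1 + t).
have r0 : 0 < r by rewrite /r tE; lra.
have r1 : r < 1 by rewrite /r tE; lra.
pose kappa : R := expR (- ((\int[lebesgue_measure]_x (x ^+ 2 * g x)) / 2)).
have kappa0 : 0 < kappa by exact: expR_gt0.
(* [L ^+ q] collects the factors [kappa ^- q], [D ^- q] and [t ^- q] of the bound. *)
pose L := (kappa * D * t)^-1.
have L0 : 0 < L by case/andP: t01 => t0 _; rewrite invr_gt0 mulr_gt0// mulr_gt0.
(* [A <= M] places all sizes above [M * p n] in the range of decrease; the second condition gains a
   factor 1/2 per unit of [p n]. *)
have [M [AM LM]] : exists M, (A <= M)%N /\ L ^+ A * r ^+ M <= 2^-1.
  have rM : L ^+ A * r ^+ M @[M --> \oo] --> (0 : R).
    rewrite -(mulr0 (L ^+ A)); apply: cvgMl_tmp; apply: cvg_expr.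
    by rewrite ger0_norm ?ltW.
  have [N _ HN] : \forall M \near \oo, L ^+ A * r ^+ M <= 2^-1.
    by apply: (cvgr_le 0) => //; rewrite invr_gt0.
  by exists (maxn A N); rewrite leq_maxl; split => //; apply: HN; exact: leq_maxr.
exists M%:R; split; first by rewrite ltr0n; exact: leq_trans AM.
pose u n := (1 - r)^-1 * 2^-1 ^+ p n : R.
have u_cvg : u n @[n --> \oo] --> (0 : R).
  rewrite -(mulr0 (1 - r)^-1); apply: cvgMl_tmp.
  apply: (cvg_comp p (fun k => 2^-1 ^+ k) p_oo); apply: cvg_expr.
  by rewrite ger0_norm ?invr_ge0// invf_lt1// ltr1n.
apply: (@squeeze_cvge _ _ _ _ (cst 0%E) _ (EFin \o u)); last 2 first.
- exact: cvg_cst.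
- by apply: cvg_EFin; [exact: nearW|exact: u_cvg].
exists 1%N => // n /= n0.
apply/andP; split.
  (* The zero vector lies in the ball, so the supremum dominates a nonnegative expectation. *)
  apply: le_trans (ereal_sup_ubound _); last first.
    exists [tuple 0 | i < n]; last by [].
    rewrite /l0_ball/= (_ : supp _ = finset.set0) ?cards0//.
    by apply/setP => i; rewrite !inE tnth_mktuple eqxx.
  apply: expectation_ge0 => X; apply: divr_ge0;
    by apply: Rintegral_ge0 => eta _; exact: gauss_pdf_ge0.
apply: ge_ereal_sup => _ [theta theta_p <-]; rewrite unlock.
set q := (A * p n)%N.
apply: le_trans (expectation_posterior_le (q := q) (t := t) (D := D) (gSE n)
  mean0 var_fin _ _ _ D_gt0 t01) _.
- by apply: leq_trans theta_p _; rewrite leq_pmull.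
- move=> m; rewrite -natrM ltr_nat; apply: leq_ltn_trans.
  by rewrite leq_mul2r AM orbT.
- move=> m /andP[qm mn]; apply: le_trans (decr n m n0 _ mn) _.
    apply: le_lt_trans (_ : q%:R < m%:R); last by rewrite ltr_nat.
    by rewrite natrM ler_wpM2r.
  rewrite ler_wpM2r ?le_max ?lexx//.
  by rewrite ltW// dim_pmf_gt0// (leq_trans (leq_pred m)).
rewrite lee_fin -/kappa.
have tq0 : t ^+ q != 0 by rewrite expf_neq0// gt_eqF//; case/andP: t01.
have Dq0 : D ^+ q != 0 by rewrite expf_neq0// gt_eqF.
(* Writing [D ^+ (m - q)] as [D ^+ m / D ^+ q] leaves a pure geometric series in [r]. *)
rewrite (eq_bigr (fun m : 'I_n.+1 => (D * t) ^- q * r ^+ m)); last first.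
  move=> m; rewrite -natrM ltr_nat => Mm.
  have qm : (q <= m)%N by rewrite ltnW// (leq_ltn_trans _ Mm)// leq_mul2r AM orbT.
  rewrite !exprMn (_ : D ^+ m = D ^+ (m - q) * D ^+ q); last first.
    by rewrite -exprD subnK.
  move: tq0 Dq0; move: (t ^+ q) (D ^+ q) => a b a0 b0.
  by rewrite invfM; field; rewrite a0 b0.
rewrite -mulr_sumr mulrA (_ : kappa ^- q * (D * t) ^- q = L ^+ q); last first.
  by rewrite /L exprVn !exprMn !invfM mulrA.
under eq_bigl do rewrite -natrM ltr_nat.
have tail := geometric_tail_le (M * p n) n.+1 (r := r).
rewrite /u ler_pdivlMl ?subr_gt0// mulrCA.
apply: (@le_trans _ _ (L ^+ q * r ^+ (M * p n))).
  by rewrite ler_wpM2l ?exprn_ge0 ?(ltW L0)// tail// !ltW.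
(* As [q = A * p n], the bound is the power [p n] of [L ^+ A * r ^+ M], which is at most 1/2. *)
rewrite !exprM -exprMn; apply: lerXn2r => //; rewrite nnegrE ?invr_ge0//.
by rewrite mulr_ge0 ?exprn_ge0// ltW.
Qed.
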